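(* Assume Hypothesis (H), and let $(x_k)_{k\geq0}$ be the Newton iterates $F'_{x_k}(x_{k+1}-x_k)=-F(x_k)$ with $x_0=0$. Define recursively $\xi_0=0$, $\tilde M_0=M$, $\tilde a_0=a$, and for $k\geq 0$: $$w_k=\tilde M_k^{-1}\tilde a_k,\quad \xi_{k+1}=\xi_k+w_k,\quad \tilde a_{k+1}=b(w_k,w_k),\quad \tilde M_{k+1}=\tilde M_k-b(w_k,\cdot)-b(\cdot,w_k).$$ Then for every $k\geq 0$, $\tilde M_k$ is nonsingular and $\xi_k=x_k$, $\tilde M_k=F'_{x_k}$, $\tilde a_k=-F(x_k)$, and $w_k=x_{k+1}-x_k$.
   Context: Inequalities between vectors/matrices are componentwise. An M-matrix is a matrix $sI-P$ with $P\geq0$ entrywise and $s\geq\rho(P)$ ($\rho$ = spectral radius). Let $M\in\mathbb R^{n\times n}$ be a nonsingular M-matrix, $a\in\mathbb R^n$ with $a\geq 0$, and $b:\mathbb R^n\times\mathbb R^n\to\mathbb R^n$ a bilinear map (not necessarily symmetric) with $b(x,y)\geq 0$ whenever $x,y\geq 0$. A solution of $Mx=a+b(x,x)$ means a vector $x\geq 0$ satisfying it; a solution $x_\ast$ is minimal if $x_\ast\leq y$ for every solution $y$. $F(x):=Mx-a-b(x,x)$. For $x\in\mathbb R^n$, $b(x,\cdot)$ and $b(\cdot,x)$ denote the $n\times n$ matrices of $y\mapsto b(x,y)$ and $y\mapsto b(y,x)$; $F'_x:=M-b(x,\cdot)-b(\cdot,x)$. Hypothesis (H): the equation has a minimal solution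 $x_\ast$, $x_\ast>0$ (all components strictly positive), and either $F'_{x_\ast}$ is nonsingular, or $F'_{x_\ast}$ is irreducible and $F'_x\neq F'_{x_\ast}$ for every $x$ with $0\leq x\leq x_\ast$, $x\neq x_\ast$. *)

(* Defs.v *)
(* Scalars live in an arbitrary numeric algebraically closed
   field C (e.g. the complex numbers); the order on C is the partial order
   x <= y <-> y - x is a nonnegative real. Spectral radius needs complex
   eigenvalues, hence the closed field. *)
From HB Require Import structures.
From mathcomp Require Import all_boot all_order all_algebra.
Set Implicit Arguments. Unset Strict Implicit. Unset Printing Implicit Defensive.
Import Order.TTheory GRing.Theory Num.Theory.
Local Open Scope ring_scope.

Section Defs.
Variables (C : numClosedFieldType) (n : nat).

Definition vle (x y : 'cV[C]_n) : Prop := forall i, x i 0 <= y i 0.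
Definition mnonneg (P : 'M[C]_n) : Prop := forall i j, 0 <= P i j.

Definition spec_rad_le (P : 'M[C]_n) (s : C) : Prop :=
  forall l, eigenvalue P l -> `|l| <= s.

Definition Mmatrix (A : 'M[C]_n) : Prop :=
  exists (s : C) (P : 'M[C]_n), mnonneg P /\ spec_rad_le P s /\ A = s%:M - P.

(* irreducible: no nonempty proper index set I with A i j = 0 for all
   i in I, j not in I (i.e. A is not permutation-similar to a block
   triangular matrix) *)
Definition irreducible_mx (A : 'M[C]_n) : Prop :=
  forall I : {set 'I_n}, I != set0 -> I != setT ->
    exists i j, [/\ i \in I, j \notin I & A i j != 0].

(* A bilinear map b : C^n x C^n -> C^n given by its coefficient tensor:
   b(x,y)_i = sum_{j,k} c i j k * x_j * y_k  *)
Definition bapp (c : 'I_n -> 'I_n -> 'I_n -> C) (x y : 'cV[C]_n) : 'cV[C]_n :=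
  \col_i \sum_j \sum_k c i j k * x j 0 * y k 0.
(* matrix of y |-> b(x,y) *)
Definition bL (c : 'I_n -> 'I_n -> 'I_n -> C) (x : 'cV[C]_n) : 'M[C]_n :=
  \matrix_(i, k) \sum_j c i j k * x j 0.
(* matrix of y |-> b(y,x) *)
Definition bR (c : 'I_n -> 'I_n -> 'I_n -> C) (x : 'cV[C]_n) : 'M[C]_n :=
  \matrix_(i, j) \sum_k c i j k * x k 0.

Variables (M : 'M[C]_n) (a : 'cV[C]_n) (c : 'I_n -> 'I_n -> 'I_n -> C).

Definition Fmap (x : 'cV[C]_n) : 'cV[C]_n := M *m x - a - bapp c x x.
Definition Fder (x : 'cV[C]_n) : 'M[C]_n := M - bL c x - bR c x.

Definition is_solution (x : 'cV[C]_n) : Prop := vle 0 x /\ Fmap x = 0.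
Definition minimal_solution (x : 'cV[C]_n) : Prop :=
  is_solution x /\ forall y, is_solution y -> vle x y.

Definition HypH : Prop :=
  exists xs : 'cV[C]_n,
    [/\ minimal_solution xs, (forall i, 0 < xs i 0) &
        (Fder xs \in unitmx \/
         (irreducible_mx (Fder xs) /\
          forall x, vle 0 x -> vle x xs -> x <> xs -> Fder x <> Fder xs))].

Fixpoint rec_seq (k : nat) : 'cV[C]_n * 'M[C]_n * 'cV[C]_n :=
  match k with
  | 0 => (0, M, a)
  | k'.+1 =>
    let: (xi, Mt, at_) := rec_seq k' in
    let w := invmx Mt *m at_ in
    (xi + w, Mt - bL c w - bR c w, bapp c w w)
  end.

Definition xi_seq k := (rec_seq k).1.1.
Definition Mt_seq k := (rec_seq k).1.2.
Definition at_seq k := (rec_seq k).2.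
Definition w_seq k := invmx (Mt_seq k) *m at_seq k.

End Defs.

(* Main.v *)
(** The point is that every Newton matrix F'_x with x = x_k is inverse-nonnegative;
    the rest is the expansion F (x + w) = F x + F'_x w - b(w, w).

    Let xs > 0 be the solution, e = xs - x_{k+1},
    w = x_{k+1} - x_k and A = F'_{x_{k+1}}.  Expanding F at xs gives
    A e = b(e, e) + b(w, w) >= 0, where A has nonpositive off-diagonal entries.
    The indices S with e_i = 0 form a subsystem of equations decoupled from the
    other unknowns.  On S, A inherits inverse-nonnegativity from F'_{x_k}: it
    agrees with F'_{x_k} on the diagonal blocks of the indices settled before
    step k+1 and of those settled at step k+1.  Off S, e is a positive
    vector with A e >= 0, so a failure of inverse-nonnegativity would produce a
    set Z of indices such that S together with Z is an invariant block on which
    F'_{xs} e = 0 and b vanishes on the Z rows; this contradicts the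
    nonsingularity, or the irreducibility, of F'_{xs}. *)
Require Import Defs.
From HB Require Import structures.
From mathcomp Require Import all_boot all_order all_algebra ring.
Set Implicit Arguments. Unset Strict Implicit. Unset Printing Implicit Defensive.
Import Order.TTheory GRing.Theory Num.Theory.
Local Open Scope ring_scope.

(** * Real Z-matrices and inverse-nonnegativity *)

Section Zmatrices.
Context {C : numClosedFieldType} {n : nat}.
Implicit Types (A : 'M[C]_n) (y v : 'cV[C]_n) (K Z : {set 'I_n}).

Definition real_mx A := forall i j, A i j \is Num.real.
Definition Zmx A := forall i j, i != j -> A i j <= 0.
Definition inverse_nonneg A :=
  A \in unitmx /\ forall y, vle 0 (A *m y) -> vle 0 y.

Lemma vle0P (x : 'cV[C]_n) : vle 0 x <-> forall i, 0 <= x i 0.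
Proof. by split=> h i; have := h i; rewrite mxE. Qed.

(** With [D] the coordinate projection onto [K], the zero block gives [D A D = D A], so the row
    space of [D A] lies in that of [D]. Invertibility of [A] makes the ranks equal, hence
    [D = X D A] for some [X], and [D v = X D A v = 0]. *)
Lemma unitmx_block_inj A K v :
  A \in unitmx -> (forall i j, i \in K -> j \notin K -> A i j = 0) ->
  (forall i, i \in K -> (A *m v) i 0 = 0) -> forall i, i \in K -> v i 0 = 0.
Proof.
move=> uA AK Av i iK.
pose D : 'M[C]_n := diag_mx (\row_j (j \in K)%:R).
have DE m (B : 'M[C]_(n, m)) r s : (D *m B) r s = (r \in K)%:R * B r s.
  by rewrite mul_diag_mx !mxE.
have DAD : D *m A *m D = D *m A.
  apply/matrixP=> r s; rewrite mul_mx_diag mxE DE mxE -mulrA.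
  case rK: (r \in K); last by rewrite !mul0r.
  by case sK: (s \in K); rewrite ?mulr1 // AK ?rK ?sK ?mulr0.
have sub : (D *m A <= D)%MS by rewrite -DAD submxMl.
have /submxP [X DX] : (D <= D *m A)%MS.
  by rewrite -(mxrank_leqif_sup sub) mxrankMfree ?row_free_unit.
have : D *m v = 0.
  rewrite DX -!mulmxA; suff -> : D *m (A *m v) = 0 by rewrite mulmx0.
  apply/colP=> r; rewrite DE [RHS]mxE.
  by case rK: (r \in K); rewrite ?mul0r // Av ?mulr0.
by move/colP/(_ i); rewrite DE iK mul1r mxE.
Qed.

(* Compare y with v through the indices of K where y/v is minimal. *)
Lemma Zmx_block A K y v :
    Zmx A -> real_mx A -> (forall i, y i 0 \is Num.real) ->
    (forall i, i \in K -> 0 < v i 0) ->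
    (forall i, i \in K -> 0 <= (A *m y) i 0) ->
    (forall i j, i \in K -> j \notin K -> A i j * y j 0 <= 0) ->
    (forall i, i \in K -> 0 <= \sum_(j in K) A i j * v j 0) ->
  (forall i, i \in K -> 0 <= y i 0) \/
  exists Z, [/\ Z != set0, Z \subset K,
    (forall i j, i \in Z -> j \in K -> j \notin Z -> A i j = 0) &
    (forall i, i \in Z -> \sum_(j in K) A i j * v j 0 = 0)].
Proof.
move=> ZA RA Ry v0 Ay Aoff Av.
case: (boolP [forall i in K, 0 <= y i 0]) => [/forall_inP|]; first by left.
rewrite negb_forall_in => /exists_inP [i0 i0K yi0]; right.
have yi0N : y i0 0 < 0 by rewrite real_ltNge // ?real0 ?Ry.
pose r i := y i 0 / v i 0.
have Rr : {in mem K, forall i, r i \is Num.real}.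
  by move=> i iK; rewrite /r realM ?Ry // realV gtr0_real ?v0.
have [i1 i1K r_min] := real_arg_minP (P := mem K) i0K Rr.
set t := r i1.
have t0 : t < 0.
  apply: le_lt_trans (r_min i0 i0K) _.
  by rewrite /r pmulr_llt0 // invr_gt0 v0.
have yt j : j \in K -> 0 <= y j 0 - t * v j 0.
  by move=> jK; rewrite subr_ge0 -ler_pdivlMr ?v0 // r_min.
have yteq j : j \in K -> (y j 0 - t * v j 0 == 0) = (r j == t).
  move=> jK; have vj : v j 0 != 0 by rewrite gt_eqF ?v0.
  by rewrite subr_eq0 /r; apply/eqP/eqP => [->|<-]; rewrite ?mulfK ?divfK.
pose Z := [set i in K | r i == t].
(* Row [i] of [A y] splits into the [K]-sum against [y - t v], [t] times the [K]-sum against [v],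
   and the columns outside [K]. All three are nonpositive and the total is nonnegative, so the first
   two vanish, the first one term by term. *)
have key i : i \in Z ->
    (forall j, j \in K -> A i j * (y j 0 - t * v j 0) = 0) /\
    \sum_(j in K) A i j * v j 0 = 0.
  rewrite inE => /andP [iK ri].
  have le0 j : j \in K -> A i j * (y j 0 - t * v j 0) <= 0.
    move=> jK; case: (eqVneq i j) => [<-|ij].
      by move: ri; rewrite -yteq // => /eqP ->; rewrite mulr0.
    by rewrite mulr_le0_ge0 ?ZA ?yt.
  have s1 : \sum_(j in K) A i j * (y j 0 - t * v j 0) <= 0 by apply: sumr_le0.
  have s2 : t * \sum_(j in K) A i j * v j 0 <= 0.
    by rewrite mulr_le0_ge0 ?Av // ltW.
  have s3 : 0 <= \sum_(j in K) A i j * (y j 0 - t * v j 0)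
                 + t * \sum_(j in K) A i j * v j 0.
    apply: le_trans (Ay i iK) _.
    rewrite mxE (bigID (mem K)) /= -[leRHS]addr0 lerD //.
      rewrite mulr_sumr -big_split /= le_eqVlt; apply/orP; left; apply/eqP.
      by apply: eq_bigr => j _; rewrite mulrBr (mulrCA t) subrK.
    by apply: sumr_le0 => j; apply: Aoff.
  have e1 : \sum_(j in K) A i j * (y j 0 - t * v j 0) = 0.
    apply/eqP; rewrite eq_le s1 /=; apply: le_trans s3 _.
    by rewrite -[leRHS]addr0 lerD2l.
  have e2 : \sum_(j in K) A i j * v j 0 = 0.
    move: s3; rewrite e1 add0r => s3.
    have /eqP : t * \sum_(j in K) A i j * v j 0 = 0.
      by apply/eqP; rewrite eq_le s2.
    by rewrite mulf_eq0 lt_eqF //= => /eqP.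
  split=> // j jK; apply: oppr_inj; rewrite oppr0.
  apply: (psumr_eq0P (P := mem K)
    (F := fun j => - (A i j * (y j 0 - t * v j 0)))) => //.
    by move=> k kK; rewrite oppr_ge0 le0.
  by rewrite sumrN e1 oppr0.
exists Z; split.
- by apply/set0Pn; exists i1; rewrite inE eqxx andbT.
- by apply/subsetP=> i; rewrite inE => /andP [].
- move=> i j iZ jK jZ; have [/(_ j jK)/eqP + _] := key i iZ.
  rewrite mulf_eq0 yteq // => /orP [/eqP //|rj].
  by rewrite inE jK rj in jZ.
- by move=> i /key [].
Qed.

(** A real matrix commutes with real and imaginary parts, so injectivity on real vectors extends to
    complex ones. If [A y] is nonnegative it is real, which puts [im y] in the kernel. *)
Lemma real_inverse_nonneg A : real_mx A ->
  (forall y, (forall i, y i 0 \is Num.real) -> vle 0 (A *m y) -> vle 0 y) ->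
  inverse_nonneg A.
Proof.
move=> RA mono.
have ker0 y : (forall i, y i 0 \is Num.real) -> A *m y = 0 -> y = 0.
  move=> Ry Ay.
  have y1 : vle 0 y by apply: mono => // i; rewrite Ay !mxE.
  have y2 : vle 0 (- y).
    apply: mono => [i|i]; first by rewrite mxE realN.
    by rewrite mulmxN Ay !mxE oppr0.
  apply/colP=> i; apply/eqP; rewrite eq_le.
  by have := y1 i; have := y2 i; rewrite !mxE oppr_ge0 => -> ->.
pose re y : 'cV[C]_n := \col_i 'Re (y i 0).
pose im y : 'cV[C]_n := \col_i 'Im (y i 0).
have Rre y i : re y i 0 \is Num.real by rewrite mxE Creal_Re.
have Rim y i : im y i 0 \is Num.real by rewrite mxE Creal_Im.
have Are y : A *m re y = re (A *m y).
  apply/colP=> i; rewrite !mxE raddf_sum.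
  by apply: eq_bigr => j _; rewrite mxE /= ReMl.
have Aim y : A *m im y = im (A *m y).
  apply/colP=> i; rewrite !mxE raddf_sum.
  by apply: eq_bigr => j _; rewrite mxE /= ImMl.
have reimE y : y = re y + 'i *: im y.
  by apply/colP=> i; rewrite !mxE -Crect.
split=> [|y Ay].
  rewrite -unitmx_tr -row_free_unit -kermx_eq0; apply/eqP/row_matrixP=> i.
  rewrite row0; apply: trmx_inj; rewrite trmx0.
  set y := (row i _)^T.
  have Ay : A *m y = 0.
    apply: trmx_inj; rewrite trmx_mul trmxK -row_mul mulmx_ker row0.
    by rewrite trmx0.
  have re0 : re y = 0.
    by apply: ker0 => //; rewrite Are Ay; apply/colP=> k; rewrite !mxE raddf0.
  have im0 : im y = 0.
    by apply: ker0 => //; rewrite Aim Ay; apply/colP=> k; rewrite !mxE raddf0.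
  by rewrite [LHS]reimE re0 im0 scaler0 addr0.
have RAy i : (A *m y) i 0 \is Num.real.
  by apply: ger0_real; have := Ay i; rewrite [X in X <= _]mxE.
have im0 : im y = 0.
  apply: ker0 => //; rewrite Aim; apply/colP=> i.
  by rewrite mxE [RHS]mxE; apply/Creal_ImP.
have yE : y = re y by rewrite {1}(reimE y) im0 scaler0 addr0.
by rewrite yE; apply: mono => //; rewrite -yE.
Qed.

(** Take [g = A^-1 1], which is nonnegative. If [g i 0] were zero, row [i] of [A g] would contain
    only nonpositive off-diagonal terms, yet it equals 1. *)
Lemma inverse_nonneg_pos A : Zmx A -> inverse_nonneg A ->
  exists g : 'cV[C]_n, (forall i, 0 < g i 0) /\ (forall i, (A *m g) i 0 = 1).
Proof.
move=> ZA [uA mono]; pose g := invmx A *m (const_mx 1 : 'cV[C]_n).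
have Ag i : (A *m g) i 0 = 1 by rewrite mulKVmx // mxE.
have /vle0P g0 : vle 0 g by apply/mono/vle0P => i; rewrite Ag.
exists g; split=> // i; rewrite lt_def g0 andbT; apply/eqP=> gi.
have : (A *m g) i 0 <= 0.
  rewrite mxE; apply: sumr_le0 => j _.
  case: (eqVneq i j) => [<-|ij]; first by rewrite gi mulr0.
  by rewrite mulr_le0_ge0 ?ZA.
by rewrite Ag ler10.
Qed.

(** Transfers positivity from [A] to a matrix sharing its block on [K]. Dropping the columns outside
    [K] can only raise the rows of [A g = 1], so with [v = g] the second alternative of [Zmx_block],
    which has zero row sums, is excluded. *)
Lemma Zmx_block_inverse_nonneg A B (K : {set 'I_n}) y :
    Zmx A -> inverse_nonneg A -> Zmx B -> real_mx B ->
    (forall i j, i \in K -> j \in K -> B i j = A i j) ->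
    (forall i, y i 0 \is Num.real) ->
    (forall i, i \in K -> 0 <= (B *m y) i 0) ->
    (forall i j, i \in K -> j \notin K -> B i j * y j 0 <= 0) ->
  forall i, i \in K -> 0 <= y i 0.
Proof.
move=> ZA pA ZB RB BA Ry By Boff.
have [g [g0 Ag]] := inverse_nonneg_pos ZA pA.
have Bg i : i \in K -> 1 <= \sum_(j in K) B i j * g j 0.
  move=> iK; rewrite -(Ag i) mxE (bigID (mem K)) /=.
  rewrite (eq_bigr (fun j => B i j * g j 0)) => [|j jK]; last by rewrite BA.
  rewrite -[leRHS]addr0 lerD2l; apply: sumr_le0 => j jK.
  rewrite mulr_le0_ge0 ?(ltW (g0 _)) // ZA //.
  by apply: contraNneq jK => <-.
have [||//|[Z [/set0Pn [i iZ] sZ _ Z0]]] := Zmx_block (v := g) ZB RB Ry _ By Boff.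
- by move=> i _.
- by move=> i iK; apply: le_trans (Bg i iK).
by have := Bg i (subsetP sZ i iZ); rewrite Z0 // ler10.
Qed.

End Zmatrices.

(** * Expansion and sign properties of [Fmap] and [Fder] *)

Section QuadraticVectorEquation.
Context {C : numClosedFieldType} {n : nat}.
Variables (M : 'M[C]_n) (a : 'cV[C]_n) (c : 'I_n -> 'I_n -> 'I_n -> C).
Implicit Types (x y w z : 'cV[C]_n).

Lemma bapp_bL x y : bapp c x y = bL c x *m y.
Proof.
apply/colP=> i; rewrite !mxE exchange_big /=.
by apply: eq_bigr => k _; rewrite mxE mulr_suml.
Qed.

Lemma bapp_bR x y : bapp c x y = bR c y *m x.
Proof.
apply/colP=> i; rewrite !mxE; apply: eq_bigr => j _; rewrite mxE mulr_suml.
by apply: eq_bigr => k _; rewrite mulrAC.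
Qed.

Lemma bLD x y : bL c (x + y) = bL c x + bL c y.
Proof.
apply/matrixP=> i k; rewrite !mxE -big_split /=.
by apply: eq_bigr => j _; rewrite mxE mulrDr.
Qed.

Lemma bRD x y : bR c (x + y) = bR c x + bR c y.
Proof.
apply/matrixP=> i k; rewrite !mxE -big_split /=.
by apply: eq_bigr => j _; rewrite mxE mulrDr.
Qed.

Lemma FderD x w : Fder M c (x + w) = Fder M c x - bL c w - bR c w.
Proof.
by rewrite /Fder bLD bRD !opprD !addrA; congr (_ + _); rewrite addrAC.
Qed.

Lemma FderE x i j : Fder M c x i j =
  M i j - \sum_k c i k j * x k 0 - \sum_k c i j k * x k 0.
Proof. by rewrite !mxE. Qed.

Lemma FmapD x w :
  Fmap M a c (x + w) = Fmap M a c x + Fder M c x *m w - bapp c w w.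
Proof.
rewrite /Fmap /Fder !bapp_bL bLD mulmxDl !mulmxDr !mulmxBl.
rewrite -!bapp_bL -!bapp_bR.
move: (M *m x) (M *m w) (bapp c x x) (bapp c x w) (bapp c w x) (bapp c w w).
by move=> ? ? ? ? ? ?; apply/colP=> i; rewrite !mxE; ring.
Qed.

Lemma Fmap_newton x w :
  Fder M c x *m w = - Fmap M a c x -> Fmap M a c (x + w) = - bapp c w w.
Proof. by move=> wE; rewrite FmapD wE subrr sub0r. Qed.

Hypothesis c_ge0 : forall i j k, 0 <= c i j k.

Lemma bapp_ge0 x y i :
  (forall j, 0 <= x j 0) -> (forall j, 0 <= y j 0) -> 0 <= bapp c x y i 0.
Proof.
move=> x0 y0; rewrite mxE; apply: sumr_ge0 => j _; apply: sumr_ge0 => k _.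
by rewrite !mulr_ge0.
Qed.

Lemma bapp_eq0 z i : (forall j, 0 <= z j 0) -> bapp c z z i 0 = 0 ->
  forall j k, 0 < z j 0 -> 0 < z k 0 -> c i j k = 0.
Proof.
move=> z0 bz j k zj zk; move: bz; rewrite mxE.
have t0 r s : 0 <= c i r s * z r 0 * z s 0 by rewrite !mulr_ge0.
move=> /(psumr_eq0P (fun r _ => sumr_ge0 _ (fun s _ => t0 r s))) /(_ j isT).
move=> /(psumr_eq0P (fun s _ => t0 j s)) /(_ k isT) /eqP.
by rewrite !mulf_eq0 (gt_eqF zj) (gt_eqF zk) !orbF => /eqP.
Qed.

Hypotheses (MR : real_mx M) (MZ : Zmx M).

Lemma Fder_real x : (forall i, 0 <= x i 0) -> real_mx (Fder M c x).
Proof.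
move=> x0 i j; rewrite FderE; apply: realB; first apply: realB => //.
  by apply/ger0_real/sumr_ge0 => k _; rewrite mulr_ge0.
by apply/ger0_real/sumr_ge0 => k _; rewrite mulr_ge0.
Qed.

Lemma Fder_Z x : (forall i, 0 <= x i 0) -> Zmx (Fder M c x).
Proof.
move=> x0 i j ij; rewrite FderE -addrA -opprD subr_le0.
by apply: le_trans (MZ ij) _; rewrite addr_ge0 // sumr_ge0 // => k _;
  rewrite mulr_ge0.
Qed.

(** * Settled indices and closed subsystems below a positive solution *)

Variable xs : 'cV[C]_n.
Hypotheses (xs_gt0 : forall i, 0 < xs i 0) (Fxs : Fmap M a c xs = 0).

(** Phrased on [M] and [c] rather than on [Fder], so that one closed set gives a zero block of the
    derivative at every point, [x] and [xs] alike. *)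
Definition closed_set (S : {set 'I_n}) :=
  forall i, i \in S -> (forall j, j \notin S -> M i j = 0) /\
    (forall j k, (j \notin S) || (k \notin S) -> c i j k = 0).

Definition settled x : {set 'I_n} := [set i | x i 0 == xs i 0].

Lemma closed_Fder S x i j :
  closed_set S -> i \in S -> j \notin S -> Fder M c x i j = 0.
Proof.
move=> clS iS jS; have [Mij cij] := clS i iS.
rewrite FderE Mij // !big1 ?subr0 // => k _.
  by rewrite cij ?mul0r ?jS.
by rewrite cij ?mul0r ?jS ?orbT.
Qed.

Lemma Fder_gap x :
  Fder M c x *m (xs - x) = bapp c (xs - x) (xs - x) - Fmap M a c x.
Proof.
apply/eqP; rewrite eq_sym subr_eq eq_sym addrC -subr_eq0 -FmapD.
by rewrite addrC subrK Fxs.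
Qed.

Section BelowSolution.
Variable x : 'cV[C]_n.
Hypotheses (x_ge0 : forall i, 0 <= x i 0) (x_le : vle x xs).
Hypothesis Fx_le0 : vle (Fmap M a c x) 0.
Let S := settled x.
Let e := xs - x.

Lemma gap_ge0 i : 0 <= e i 0.
Proof. by rewrite !mxE subr_ge0. Qed.

Lemma gap_eq0 i : (e i 0 == 0) = (i \in S).
Proof. by rewrite !mxE inE subr_eq0 eq_sym. Qed.

Lemma gap_settled i : i \in S -> e i 0 = 0.
Proof. by rewrite -gap_eq0 => /eqP. Qed.

Lemma gap_gt0 i : i \notin S -> 0 < e i 0.
Proof. by rewrite lt_def gap_ge0 gap_eq0 andbT. Qed.

Lemma bapp_gap_le i : bapp c e e i 0 <= (Fder M c x *m e) i 0.
Proof.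
rewrite Fder_gap [leRHS]mxE -[leLHS]addr0 lerD2l mxE oppr_ge0.
by have := Fx_le0 i; rewrite [X in _ <= X]mxE.
Qed.

(** For [i] in [S] the diagonal term of row [i] of [F'_x e] is zero and the others are nonpositive,
    while the row dominates [b(e,e)_i >= 0]; everything vanishes. Zero entries of [F'_x] outside [S]
    then kill [M i j] and the mixed coefficients, as [x > 0] on [S]; [b(e,e)_i = 0] kills those with
    both indices outside [S]. *)
Lemma settled_closed : closed_set S.
Proof.
move=> i iS.
have AZ := Fder_Z x_ge0.
have t0 j : Fder M c x i j * e j 0 <= 0.
  case: (eqVneq i j) => [<-|ij]; first by rewrite gap_settled ?mulr0.
  by rewrite mulr_le0_ge0 ?AZ ?gap_ge0.
have Ae0 : (Fder M c x *m e) i 0 <= 0 by rewrite mxE; apply: sumr_le0.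
have be0 := bapp_ge0 i gap_ge0 gap_ge0.
have be : bapp c e e i 0 = 0.
  by apply/eqP; rewrite eq_le be0 andbT (le_trans (bapp_gap_le i)).
have Ae : (Fder M c x *m e) i 0 = 0.
  by apply/eqP; rewrite eq_le Ae0 (le_trans be0) ?bapp_gap_le.
have A0 j : j \notin S -> Fder M c x i j = 0.
  move=> jS; apply/eqP; move: Ae; rewrite mxE => Ae.
  have : - (Fder M c x i j * e j 0) = 0.
    apply: (psumr_eq0P (P := xpredT)
      (F := fun k => - (Fder M c x i k * e k 0))) => //.
      by move=> k _; rewrite oppr_ge0.
    by rewrite sumrN Ae oppr0.
  by move/eqP; rewrite oppr_eq0 mulf_eq0 (gt_eqF (gap_gt0 jS)) orbF.
have ij j : j \notin S -> i != j by apply: contraNneq => <-.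
have sums j : j \notin S -> [/\ M i j = 0,
    \sum_k c i k j * x k 0 = 0 & \sum_k c i j k * x k 0 = 0].
  move=> jS; have M0 := MZ (ij j jS).
  have s1 : 0 <= \sum_k c i k j * x k 0.
    by apply: sumr_ge0 => k _; rewrite mulr_ge0.
  have s2 : 0 <= \sum_k c i j k * x k 0.
    by apply: sumr_ge0 => k _; rewrite mulr_ge0.
  have : 0 <= M i j - \sum_k c i k j * x k 0 - \sum_k c i j k * x k 0.
    by rewrite -FderE A0.
  rewrite -addrA -opprD subr_ge0 => s12.
  have M1 : M i j = 0.
    by apply/eqP; rewrite eq_le M0 (le_trans _ s12) ?addr_ge0.
  move: s12; rewrite M1 => s12.
  have /eqP : \sum_k c i k j * x k 0 + \sum_k c i j k * x k 0 = 0.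
    by apply/eqP; rewrite eq_le s12 addr_ge0.
  by rewrite paddr_eq0 // => /andP [/eqP -> /eqP ->].
have xS k : k \in S -> 0 < x k 0 by rewrite inE => /eqP ->.
split=> [j /sums [] //|j k jk].
case: (boolP (j \in S)) jk => [jS|jS] /=; last first.
  move=> _; case: (boolP (k \in S)) => [kS|kS]; last first.
    exact: (bapp_eq0 gap_ge0 be (gap_gt0 jS) (gap_gt0 kS)).
  have [_ _] := sums j jS.
  move=> /(psumr_eq0P (fun l _ => mulr_ge0 (c_ge0 i j l) (x_ge0 l))).
  by move=> /(_ k isT) /eqP; rewrite mulf_eq0 (gt_eqF (xS k kS)) orbF => /eqP.
move=> kS; have [_ + _] := sums k kS.
move=> /(psumr_eq0P (fun l _ => mulr_ge0 (c_ge0 i l k) (x_ge0 l))).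
by move=> /(_ j isT) /eqP; rewrite mulf_eq0 (gt_eqF (xS j jS)) orbF => /eqP.
Qed.

Lemma Fmap_settled i : i \in S -> Fmap M a c x i 0 = 0.
Proof.
move=> iS; have Ae : (Fder M c x *m e) i 0 = 0.
  rewrite mxE big1 // => j _; case: (boolP (j \in S)) => [/gap_settled ->|jS].
    by rewrite mulr0.
  by rewrite (closed_Fder _ settled_closed) ?mul0r.
have be : bapp c e e i 0 = 0.
  apply/eqP; rewrite eq_le -{1}Ae bapp_gap_le bapp_ge0 //; apply: gap_ge0.
move: Ae; rewrite Fder_gap [LHS]mxE -/e be add0r mxE => /eqP.
by rewrite oppr_eq0 => /eqP.
Qed.

Hypothesis M_unit : M \in unitmx.
Hypothesis Fxs_alt :
  Fder M c xs \in unitmx \/ irreducible_mx (Fder M c xs).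

(** Applies [Zmx_block] on the complement of [S] with the gap [e] as positive vector; the work lies
    in refuting its second alternative. *)
Lemma unsettled_ge0 y : (forall i, y i 0 \is Num.real) ->
  vle 0 (Fder M c x *m y) -> (forall i, i \in S -> 0 <= y i 0) ->
  forall i, 0 <= y i 0.
Proof.
move=> Ry /vle0P Ay yS i.
case: (boolP (i \in S)) => [|iS]; first exact: yS.
have AZ := Fder_Z x_ge0; have AR := Fder_real x_ge0.
pose K := ~: S.
have KS j : (j \in K) = (j \notin S) by rewrite inE.
have sumK (A : 'M[C]_n) r : \sum_(j in K) A r j * e j 0 = (A *m e) r 0.
  rewrite mxE [RHS](bigID (mem K)) /= [X in _ + X]big1 ?addr0 // => j.
  by rewrite KS negbK => /gap_settled ->; rewrite mulr0.
have [||//||Yge0|[Z [/set0Pn [z zZ] sZ AZK AZ0]]] :=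
  Zmx_block (K := K) (v := e) AZ AR Ry.
- by move=> j; rewrite KS; apply: gap_gt0.
- by move=> j _; apply: Ay.
- move=> r j; rewrite !KS negbK => rS jS; rewrite mulr_le0_ge0 ?yS //.
  by apply: AZ; apply: contraNneq rS => ->.
- move=> r _; rewrite sumK; apply: le_trans (bapp_gap_le r).
  exact: bapp_ge0 gap_ge0 gap_ge0.
- by apply: Yge0; rewrite KS.
have zS r : r \in Z -> r \notin S by move=> rZ; rewrite -KS (subsetP sZ).
have cZ r j k : r \in Z -> j \notin S -> k \notin S -> c r j k = 0.
  move=> rZ jS kS; have := bapp_gap_le r; rewrite -sumK AZ0 // => b0.
  apply: (bapp_eq0 gap_ge0 _ (gap_gt0 jS) (gap_gt0 kS)).
  by apply/eqP; rewrite eq_le b0 bapp_ge0 //; apply: gap_ge0.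
(* The two derivatives differ by [b(e,.) + b(.,e)]. In a row of [Z] and a column outside [S], each
   term has either [e k 0 = 0] or a zero coefficient. *)
have FxsZ r j : r \in Z -> j \notin S -> Fder M c xs r j = Fder M c x r j.
  move=> rZ jS; rewrite -[xs](subrK x) addrC -/e FderD !mxE.
  rewrite [X in _ - X - _]big1 ?[X in _ - _ - X]big1 ?subr0 // => k _.
    by case: (boolP (k \in S)) => [/gap_settled ->|kS];
      rewrite ?mulr0 ?cZ ?mul0r.
  by case: (boolP (k \in S)) => [/gap_settled ->|kS];
    rewrite ?mulr0 ?cZ ?mul0r.
have FxsS r j : r \in S -> j \notin S -> Fder M c xs r j = 0.
  exact: closed_Fder settled_closed.
pose Q := S :|: Z.
have FxsQ r j : r \in Q -> j \notin Q -> Fder M c xs r j = 0.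
  rewrite !inE => /orP [rS|rZ] /norP [jS jZ]; first by rewrite FxsS ?inE.
  by rewrite FxsZ ?inE // AZK ?KS ?inE.
have ez := gap_gt0 (zS z zZ).
case: Fxs_alt => [U|I].
  suff e0 : e z 0 = 0 by rewrite e0 ltxx in ez.
  apply: (unitmx_block_inj U FxsQ); last by rewrite inE zZ orbT.
  move=> r; rewrite inE -sumK => /orP [rS|rZ].
    by rewrite big1 // => j; rewrite KS => jS; rewrite FxsS ?mul0r.
  by rewrite -[RHS](AZ0 r rZ); apply: eq_bigr => j; rewrite KS => jS; rewrite FxsZ.
have nosplit P : P != set0 -> P != setT ->
    (forall r j, r \in P -> j \notin P -> Fder M c xs r j = 0) -> False.
  move=> P0 PT FP; have [r [j [rP jP]]] := I P P0 PT.
  by rewrite FP // eqxx.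
(* Irreducibility forces [Q] to be everything and [S] to be empty. Then [b = 0] and [F'_x = M], so
   [M e = 0] with [e] nonzero. *)
have QT : Q = setT.
  apply/eqP/negP => /negP QT; apply: (nosplit Q) => //.
  by apply/set0Pn; exists z; rewrite inE zZ orbT.
have S0 : S = set0.
  apply/eqP/negP => /negP S0; apply: (nosplit S) => //.
  by apply: contraTneq (zS z zZ) => ->; rewrite inE.
have allZ r : r \in Z.
  by have : r \in Q; [rewrite QT inE | rewrite inE S0 inE].
have c0 r j k : c r j k = 0 by rewrite cZ // S0 inE.
have FM : Fder M c x = M.
  apply/matrixP=> r j; rewrite FderE !big1 ?subr0 // => k _;
    by rewrite c0 mul0r.
have e0 : M *m e = 0.
  by apply/colP=> r; rewrite -FM -sumK AZ0 ?mxE.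
have : e = 0 by rewrite -(mulKmx M_unit e) e0 mulmx0.
by move/colP/(_ z) => ez0; rewrite ez0 mxE ltxx in ez.
Qed.

End BelowSolution.

(** * The invariant of the Newton iteration *)

Hypotheses (M_unit : M \in unitmx) (a_ge0 : vle 0 a).
Hypothesis Fxs_alt :
  Fder M c xs \in unitmx \/ irreducible_mx (Fder M c xs).

Definition newton_inv x :=
  [/\ vle 0 x, vle x xs, vle (Fmap M a c x) 0 &
      inverse_nonneg (Fder M c x)].

(** Since [xs > 0], no index is settled at 0, so the condition on [S] in [unsettled_ge0] is
    vacuous. *)
Lemma newton_inv0 : newton_inv 0.
Proof.
have x0 i : 0 <= (0 : 'cV[C]_n) i 0 by rewrite mxE.
have x1 : vle 0 xs by move=> i; rewrite mxE ltW.
have F0 : vle (Fmap M a c 0) 0.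
  move=> i; rewrite /Fmap bapp_bL !mulmx0 subr0 sub0r !mxE oppr_le0.
  by have /vle0P := a_ge0.
split=> //.
apply: real_inverse_nonneg => [|y Ry Ay]; first exact: Fder_real.
apply/vle0P/unsettled_ge0 => //.
by move=> i; rewrite inE mxE => /eqP xi; have := xs_gt0 i; rewrite -xi ltxx.
Qed.

Lemma newton_inv_step x w :
  newton_inv x -> Fder M c x *m w = - Fmap M a c x -> newton_inv (x + w).
Proof.
move=> [/vle0P x0 xle Fx pA] wE.
have [uA monoA] := pA.
have /vle0P w0 : vle 0 w.
  apply: monoA; rewrite wE; apply/vle0P => i; rewrite mxE oppr_ge0.
  by have := Fx i; rewrite [X in _ <= X]mxE.
(* [F'_x] sends the new gap to [b(xs - x, xs - x)], because the Newton equation cancels the term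
   [F(x)]. *)
have e0 : vle 0 (xs - x - w).
  apply: monoA; rewrite mulmxBr Fder_gap wE opprK subrK.
  by apply/vle0P => i; apply: bapp_ge0 => j; rewrite !mxE subr_ge0.
have x'0 i : 0 <= (x + w) i 0 by rewrite mxE addr_ge0.
have x'le : vle (x + w) xs.
  by move=> i; move/vle0P/(_ i): e0; rewrite !mxE -addrA -opprD subr_ge0.
have Fx' : vle (Fmap M a c (x + w)) 0.
  by move=> i; rewrite Fmap_newton // mxE [leRHS]mxE oppr_le0; apply: bapp_ge0.
split=> //; first exact/vle0P.
have BR := Fder_real x'0; have BZ := Fder_Z x'0; have AZ := Fder_Z x0.
apply: real_inverse_nonneg => // y Ry By.
apply/vle0P/(unsettled_ge0 x'0) => //; move/vle0P: By => By.
have clS := settled_closed x0 xle Fx.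
have clS' := settled_closed x'0 x'le Fx'.
set S := settled x in clS *; set S' := settled (x + w) in clS' *.
have wS k : k \in S -> w k 0 = 0.
  rewrite inE => /eqP xk; apply/eqP; rewrite eq_le w0 andbT.
  by have := x'le k; rewrite mxE -xk gerDl.
have FderS i j :
    (forall k, k \notin S -> 0 < w k 0 -> c i k j = 0 /\ c i j k = 0) ->
    Fder M c (x + w) i j = Fder M c x i j.
  move=> cij; have cw k : c i k j * w k 0 = 0 /\ c i j k * w k 0 = 0.
    case: (boolP (k \in S)) => [/wS ->|/cij kS]; first by rewrite !mulr0.
    have [->|wk] := eqVneq (w k 0) 0; first by rewrite !mulr0.
    by have [|-> ->] := kS; rewrite ?mul0r // lt_def wk w0.
  rewrite FderD !mxE [X in _ - X - _]big1 ?[X in _ - _ - X]big1 ?subr0 // => k _.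
    by have [] := cw k.
  by have [] := cw k.
(* The step [w] is zero on [S], and closedness kills the coefficients through which its other
   entries could alter the [S] block of the derivative. *)
have yS i : i \in S -> 0 <= y i 0.
  apply: (Zmx_block_inverse_nonneg AZ pA BZ BR _ Ry) => [k j kS jS|k _|k j kS jS].
  - apply: FderS => l lS _; have [_ cl] := clS k kS.
    by rewrite !cl ?lS ?orbT.
  - exact: By.
  - by rewrite (closed_Fder _ clS) ?mul0r.
move=> i iS'; case: (boolP (i \in S)) => [/yS //|iS].
have iK : i \in S' :\: S by rewrite inE iS.
move: i iK {iS iS'}.
apply: (Zmx_block_inverse_nonneg AZ pA BZ BR _ Ry) => [k j|k _|k j].
(* For indices settled by this very step: [F(x + w)] vanishes there, so [b(w,w)_k = 0], and
   [w j 0 > 0] since [x j 0] had not yet reached [xs j 0]. Hence [c] vanishes on all pairs that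
   could change entry [(k, j)]. *)
- rewrite !in_setD => /andP [kS kS'] /andP [jS jS'].
  have bw : bapp c w w k 0 = 0.
    have := Fmap_settled x'0 x'le Fx' kS'.
    by rewrite Fmap_newton // mxE => /eqP; rewrite oppr_eq0 => /eqP.
  have wj : 0 < w j 0.
    rewrite lt_def w0 andbT; apply: contraNneq jS => wj.
    by move: jS'; rewrite !inE mxE wj addr0.
  by apply: FderS => l _ wl; split; apply: (bapp_eq0 w0 bw).
- exact: By.
- rewrite in_setD => /andP [kS kS']; rewrite in_setD negb_and negbK => /orP [jS|jS'].
    rewrite mulr_le0_ge0 ?yS //; apply: BZ.
    by apply: contraNneq kS => ->.
  by rewrite (closed_Fder _ clS') ?mul0r.
Qed.

End QuadraticVectorEquation.

(** * Identification of the recursion with the Newton iterates *)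

Theorem mainTheorem13 (C : numClosedFieldType) (n : nat)
  (M : 'M[C]_n) (a : 'cV[C]_n) (c : 'I_n -> 'I_n -> 'I_n -> C) :
  Mmatrix M -> M \in unitmx ->
  vle 0 a ->
  (forall x y : 'cV[C]_n, vle 0 x -> vle 0 y -> vle 0 (bapp c x y)) ->
  HypH M a c ->
  forall x : nat -> 'cV[C]_n,
    x 0%N = 0 ->
    (forall k, Fder M c (x k) *m (x k.+1 - x k) = - Fmap M a c (x k)) ->
    forall k : nat,
      [/\ Mt_seq M a c k \in unitmx,
          xi_seq M a c k = x k,
          Mt_seq M a c k = Fder M c (x k),
          at_seq M a c k = - Fmap M a c (x k) &
          w_seq M a c k = x k.+1 - x k].
Proof.
move=> [s [P [P0 [_ ME]]]] uM a0 b0 [xs [[[_ Fxs] _] xs0 alt]] x x0 xN.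
(* Nonnegativity of [b] is tested on pairs of basis vectors. *)
have c0 i j k : 0 <= c i j k.
  have delta0 l : vle 0 (delta_mx l 0 : 'cV[C]_n).
    by apply/vle0P => r; rewrite mxE ler0n.
  have /vle0P/(_ i) := b0 _ _ (delta0 j) (delta0 k).
  rewrite mxE (bigD1 j) //= (bigD1 k) //= !mxE !eqxx !mulr1.
  rewrite big1 => [|r /negPf rk]; last by rewrite !mxE rk mulr0.
  rewrite addr0 big1 ?addr0 // => r /negPf rj.
  by rewrite big1 // => l _; rewrite !mxE rj mulr0 mul0r.
have MZ : Zmx M.
  by move=> i j ij; rewrite ME !mxE (negPf ij) mulr0n sub0r oppr_le0.
(* A diagonal entry is real because row [i] of the equation at [xs] expresses [M i i * xs i 0]
   through real quantities, and [xs i 0] is positive. *)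
have MR : real_mx M.
  move=> i j; case: (eqVneq i j) => [<-|ij]; last exact/ler0_real/MZ.
  have Mxs : M *m xs = a + bapp c xs xs.
    by apply/eqP; rewrite -subr_eq0 opprD addrA; apply/eqP.
  have RMxs : (M *m xs) i 0 \is Num.real.
    rewrite Mxs mxE ger0_real // addr_ge0 ?bapp_ge0 // => [|j0|j0].
    - by have /vle0P := a0.
    - exact: ltW.
    - exact: ltW.
  have : M i i * xs i 0 \is Num.real.
    have -> : M i i * xs i 0 =
        (M *m xs) i 0 - \sum_(k | k != i) M i k * xs k 0.
      by rewrite mxE (bigD1 i) //= addrK.
    rewrite realB // sum_real // => k ki.
    by apply: realM; [apply: ler0_real; rewrite MZ // eq_sym | apply: gtr0_real].
  have xi := xs0 i.
  by rewrite realrM ?(gt_eqF xi) ?(gtr0_real xi).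
have alt' : Fder M c xs \in unitmx \/ irreducible_mx (Fder M c xs).
  by case: alt => [|[]]; [left | right].
have inv k : newton_inv M a c xs (x k).
  elim: k => [|k IHk].
    by rewrite x0; apply: newton_inv0.
  rewrite -(subrK (x k) (x k.+1)) addrC.
  by apply: newton_inv_step => //; apply: xN.
have unit k : Fder M c (x k) \in unitmx by case: (inv k) => _ _ _ [].
have wE k : invmx (Fder M c (x k)) *m (- Fmap M a c (x k)) = x k.+1 - x k.
  by rewrite -xN mulKmx.
(* The three components must be tracked together; the last one advances by [F(x + w) = - b(w,w)]
   along a Newton step. *)
have recE k : rec_seq M a c k = (x k, Fder M c (x k), - Fmap M a c (x k)).
  elim: k => [|k IHk] /=.
    rewrite x0 /Fmap bapp_bL !mulmx0 subr0 sub0r opprK; congr (_, _, _).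
    apply/matrixP=> i j; rewrite FderE !big1 ?subr0 // => k _;
    by rewrite mxE mulr0.
  rewrite IHk wE -FderD addrC subrK; congr (_, _, _).
  by have := Fmap_newton (xN k); rewrite addrC subrK => ->; rewrite opprK.
by move=> k; rewrite /w_seq /xi_seq /Mt_seq /at_seq recE /= wE.
Qed.
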